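(* Let $n\ge3$, $p_0\in\mathbb C$ and $\varepsilon>0$. Then there exists $p\in\mathbb C$ with $|p-p_0|\le\varepsilon$, $p\notin\hat\Pi$, such that, with $$q=q_0(p):=-\frac{2p(3p+n^2-1)}{(n-1)(n-2)},$$ the following holds. The polynomial $$Q(\lambda)=\lambda^n-\frac{6\lambda\left(\lambda^{n-1}-(n-1)\lambda+n-2\right)}{(n-1)(n-2)(\lambda-1)^2}+2+\frac{6p}{(n-1)(n-2)}$$ has $n$ pairwise distinct roots $\lambda_1,\dots,\lambda_n$, and there are uniquely determined amplitudes $\mu_1,\dots,\mu_n\in\mathbb C$, given by the linear system $\sum_{k=1}^n\mu_k\lambda_k^m=s_m$, $m=0,\dots,n-1$, where $s_m=m$ for $0\le m\le n-2$ and $s_{n-1}=n-1+p$, such that for every function $f(z)=\sum_{m\ge0}f_mz^m$ analytic in a neighbourhood of the origin $$zf'(z)=\sum_{k=1}^n\mu_kf(\lambda_kz)-p f_{n-1}z^{n-1}-q f_{2n-1}z^{2n-1}+r_n(z),$$ where $$r_n(z)=\sum_{m=2n}^\infty (m-S_m)f_mz^m=\frac{6np}{(n-1)(n-2)}f_{2n}z^{2n}+O(z^{2n+1}),\quad z\to0,\qquad S_m:=\sum_{k=1}^n\mu_k\lambda_k^m.$$ In particular $r_n(z)=O(z^{2n})$, and $\mu_k=\mu_k(p,n)$, $\lambda_k=\lambda_k(p,n)$ are independent of $f$. The formula is exact for polynomials of degree $\le 2n-1$: $r_n\equiv0$ if $f$ is a polynomial with $\deg f\le 2n-1$.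
   Context: Convention: $0^0=1$. The quotient in $Q$ is a polynomial: $\dfrac{\lambda(\lambda^{n-1}-(n-1)\lambda+n-2)}{(\lambda-1)^2}=\sum_{m=1}^{n-1}(n-m-1)\lambda^m$. The exceptional set is $$\hat\Pi=\left\{0;\ \tfrac n2(1-n+d_n);\ \tfrac n2(1-n-d_n)\right\},\qquad d_n=\sqrt{\tfrac23(n-1)(n-2)},$$ that is, $\hat\Pi$ is the set of zeros of $p\left(p^2+n(n-1)p+\tfrac{n^2(n^2-1)}{12}\right)$. The power-series identities are understood for $z$ in a sufficiently small neighbourhood of $0$. *)

(* Defs.v *)
From HB Require Import structures.
From mathcomp Require Import all_boot all_order all_algebra.
From mathcomp Require Import complex ring.
From mathcomp Require Import all_classical all_reals all_analysis.
Import Order.TTheory GRing.Theory Num.Theory.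
Export numFieldNormedType.Exports.

Set Implicit Arguments.
Unset Strict Implicit.
Unset Printing Implicit Defensive.

Local Open Scope classical_set_scope.
Local Open Scope complex_scope.
Local Open Scope ring_scope.

(* R[i] packed as a numClosedFieldType: MathComp-Analysis declares the normed
   topology of a field on itself for abstract numClosedFieldTypes only, so
   limits and derivatives over R[i] are inferred through this constant. *)
Definition Cplx (R : realType) : numClosedFieldType := R[i].

Definition realC (R : realType) (x : R) : Cplx R := x%:C.

Section Defs.
Variable R : realType.
Local Notation C := (Cplx R).
Implicit Types (n m : nat) (p : C).

Definition d_ n : C := sqrtC (2 / 3 * (n%:R - 1) * (n%:R - 2)).

Definition PiHat n : set C :=
  [set 0; n%:R / 2 * (1 - n%:R + d_ n); n%:R / 2 * (1 - n%:R - d_ n)].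

Definition q0 n p : C :=
  - (2 * p * (3 * p + n%:R ^+ 2 - 1)) / ((n%:R - 1) * (n%:R - 2)).

(* The division is exact, see quotQE. *)
Definition quotQ n : {poly C} :=
  ('X * ('X^(n.-1) - (n%:R - 1)%:P * 'X + (n%:R - 2)%:P)) %/ ('X - 1) ^+ 2.

Definition Q n p : {poly C} :=
  'X^n - (6 / ((n%:R - 1) * (n%:R - 2))) *: quotQ n
  + (2 + 6 * p / ((n%:R - 1) * (n%:R - 2)))%:P.

Definition s_ n p m : C := if m == n.-1 then n%:R - 1 + p else m%:R.

Definition S_ n (lam mu : 'I_n -> C) m : C := \sum_(k < n) mu k * lam k ^+ m.

Definition amplitude_system n p (lam mu : 'I_n -> C) : Prop :=
  forall m, (m < n)%N -> S_ lam mu m = s_ n p m.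

Definition power_series_at0 (fc : nat -> C) (f : C -> C) : Prop :=
  \forall z \near (0 : C), series (fun m => fc m * z ^+ m) @ \oo --> f z.

Definition rem_partial n (lam mu : 'I_n -> C) (fc : nat -> C) (z : C) :
    nat -> C :=
  fun N => \sum_(2 * n <= m < N) (m%:R - S_ lam mu m) * fc m * z ^+ m.

Definition rem_ n (lam mu : 'I_n -> C) (fc : nat -> C) (z : C) : C :=
  limn (rem_partial lam mu fc z).

Lemma quotQE n : (0 < n)%N ->
  ('X - 1) ^+ 2 * \sum_(1 <= m < n) (n%:R - m%:R - 1)%:P * 'X^m
    = 'X * ('X^(n.-1) - (n%:R - 1)%:P * 'X + (n%:R - 2)%:P) :> {poly C}
  /\ quotQ n = \sum_(1 <= m < n) (n%:R - m%:R - 1)%:P * 'X^m.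
Proof.
case: n => [//|k] _ /=.
have geom j : ('X - 1) * \sum_(1 <= m < j.+1) 'X^m = 'X^(j.+1) - 'X :> {poly C}.
  elim: j => [|j IH]; first by rewrite big_geq// mulr0 expr1 subrr.
  by rewrite big_nat_recr//= mulrDr IH !exprS; ring.
have main : ('X - 1) ^+ 2 * \sum_(1 <= m < k.+1) (k.+1%:R - m%:R - 1)%:P * 'X^m
    = 'X * ('X^k - (k.+1%:R - 1)%:P * 'X + (k.+1%:R - 2)%:P) :> {poly C}.
  elim: k => [|k IH].
    by rewrite big_geq// !polyCB -[2%:R]/(1 + 1) polyCD polyC1 expr0; ring.
  have top0 : k.+2%:R - k.+1%:R - 1 = 0 :> C by rewrite -[k.+2%:R]natr1; ring.
  rewrite big_nat_recr//= top0 polyC0 mul0r.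
  rewrite addr0 (_ : \sum_(1 <= m < k.+1) _ =
    \sum_(1 <= m < k.+1) (k.+1%:R - m%:R - 1)%:P * 'X^m
    + \sum_(1 <= m < k.+1) 'X^m); last first.
    rewrite -big_split/=; apply: eq_bigr => m _.
    by rewrite -[k.+2%:R]natr1 !polyCB !polyCD polyC1; ring.
  rewrite mulrDr IH expr2 -mulrA geom -[k.+2%:R]natr1 !polyCB !polyCD !exprS.
  by ring.
split=> //; rewrite /quotQ -main mulrC mulpK//.
by rewrite expf_neq0// -polyC1 polyXsubC_eq0.
Qed.

End Defs.

(* Main.v *)
(* The coefficient identity [m = S_m - p [m = n-1] - q [m = 2n-1]] for [m < 2n]
   comes from the linear recurrence that [Q] imposes on the power sums
   [S_m = sum_k mu_k lam_k^m]: its weights [n - j - 1] are such that [S_m = m] solves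
   the recurrence up to the term [- 6 p m / ((n-1)(n-2))], and the defect [p] of
   [S_(n-1)], met with weight [m], cancels exactly this term for [m < n-1].
   The constant [q] and the coefficient of [z^(2n)] are then the next two values of
   the recurrence. The parameter [p] enters [Q] only through its constant term, so
   all but finitely many [p] give simple roots; the amplitudes solve a Vandermonde
   system. The analytic part is termwise differentiation of [f]. *)
Require Import Defs.
From mathcomp Require Import all_boot all_order all_algebra.
From mathcomp Require Import all_classical all_reals all_analysis.
From mathcomp Require Import separable complex zify ring.
Import Order.TTheory GRing.Theory Num.Theory.

Set Implicit Arguments.
Unset Strict Implicit.
Unset Printing Implicit Defensive.

Local Open Scope classical_set_scope.
Local Open Scope ring_scope.

(** * Roots, amplitudes and power sums *)

Section Algebra.
Variables (R : realType) (n : nat).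
Hypothesis n_ge3 : (3 <= n)%N.
Local Notation C := (Cplx R).
Local Notation c := (6 / ((n%:R - 1) * (n%:R - 2)) : C).

Lemma subn1_neq0 : n%:R - 1 != 0 :> C.
Proof. by rewrite subr_eq0 pnatr_eq1; lia. Qed.

Lemma subn2_neq0 : n%:R - 2 != 0 :> C.
Proof. by rewrite subr_eq0 eqr_nat; lia. Qed.

Lemma sum_subl (K : fieldType) (x : K) (k : nat) :
  2 * \sum_(1 <= j < k.+1) (x - j%:R) = k%:R * (2 * x - k%:R - 1).
Proof.
elim: k => [|k IH]; first by rewrite big_geq// mulr0 mul0r.
by rewrite big_nat_recr//= mulrDr IH -[k.+1%:R]natr1; ring.
Qed.

Lemma sum_sublM (K : fieldType) (x : K) (k : nat) :
  6 * \sum_(1 <= j < k.+1) (x - j%:R) * j%:R =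
  k%:R * (k%:R + 1) * (3 * x - 2 * k%:R - 1).
Proof.
elim: k => [|k IH]; first by rewrite big_geq// mulr0 !mul0r.
by rewrite big_nat_recr//= mulrDr IH -[k.+1%:R]natr1; ring.
Qed.

(** The factor [c] normalizes the weights [n - j - 1], whose sum is [(n - 1) * (n - 2) / 2].
    Subtracting [2 * m] leaves [m + n], so the sequence [m] solves the recurrence [S_rec] when
    [p = 0]. *)
Lemma weighted_sum_affine (m : nat) :
  c * \sum_(1 <= j < n) (n%:R - j%:R - 1) * (m + j)%:R = 3 * m%:R + n%:R.
Proof.
have -> : \sum_(1 <= j < n) (n%:R - j%:R - 1) * (m + j)%:R =
    m%:R * \sum_(1 <= j < n) (n%:R - 1 - j%:R)
    + \sum_(1 <= j < n) (n%:R - 1 - j%:R) * j%:R :> C.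
  rewrite mulr_sumr -big_split/=; apply: eq_bigr => j _.
  by rewrite natrD; ring.
have [k nE] : exists k, n = k.+1 by exists n.-1; lia.
have := sum_subl (n%:R - 1 : C) k; have := sum_sublM (n%:R - 1 : C) k.
rewrite -nE; have -> : k%:R = n%:R - 1 :> C by rewrite nE -natr1 addrK.
set T := \sum_(_ <= _ < _) _; set U := \sum_(_ <= _ < _) _ => hT hU.
have n1 := subn1_neq0; have n2 := subn2_neq0.
rewrite mulrAC.
apply: (canLR (mulfK _)); first by rewrite mulf_neq0.
rewrite mulrDr hT (_ : 6 = 3 * 2); last by rewrite -natrM.
by rewrite [3 * 2 * _]mulrACA hU; ring.
Qed.

(** * The polynomial [Q], its roots and the amplitudes *)

Lemma QE (p : C) :
  Q n p = 'X^n - c *: \sum_(1 <= m < n) (n%:R - m%:R - 1)%:P * 'X^m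
          + (2 + c * p)%:P.
Proof.
rewrite /Q; have [//|_ ->] := @quotQE R n; first by lia.
by rewrite [6 * p / _]mulrAC.
Qed.

Lemma Q_shift (p : C) : Q n p = Q n 0 + (c * p)%:P.
Proof. by rewrite !QE mulr0 addr0 polyCD addrA. Qed.

Lemma horner_Q (p x : C) :
  (Q n p).[x] = x ^+ n - c * (\sum_(1 <= m < n) (n%:R - m%:R - 1) * x ^+ m)
                + (2 + c * p).
Proof.
rewrite QE hornerD hornerC hornerD hornerN hornerZ hornerXn horner_sum.
congr (_ - _ * _ + _).
by apply: eq_bigr => j _; rewrite !hornerE.
Qed.

Lemma size_Q_tail (p : C) :
  (size ((2 + c * p)%:P
    - c *: \sum_(1 <= m < n) (n%:R - m%:R - 1)%:P * 'X^m : {poly C})%R <= n)%N.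
Proof.
rewrite (leq_trans (size_polyD _ _))// geq_max; apply/andP; split.
  by rewrite (leq_trans (size_polyC_leq1 _))//; lia.
rewrite size_polyN (leq_trans (size_scale_leq _ _))//.
rewrite big_nat; apply: (leq_trans (size_sum _ _ _)).
apply/bigmax_leqP_seq => j _ /andP[_ jn].
by rewrite mul_polyC (leq_trans (size_scale_leq _ _))// size_polyXn.
Qed.

Lemma Q_lead (p : C) : Q n p = 'X^n + ((2 + c * p)%:P
    - c *: \sum_(1 <= m < n) (n%:R - m%:R - 1)%:P * 'X^m).
Proof. by rewrite QE addrAC addrA. Qed.

Lemma size_Q (p : C) : size (Q n p) = n.+1.
Proof. by rewrite Q_lead size_polyDl size_polyXn// ltnS size_Q_tail. Qed.

Lemma monic_Q (p : C) : Q n p \is monic.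
Proof.
rewrite monicE Q_lead lead_coefDl ?lead_coefXn//.
by rewrite size_polyXn ltnS size_Q_tail.
Qed.

Lemma deriv_Q_neq0 (p : C) : (Q n p)^`() != 0.
Proof.
apply/eqP => /(congr1 (fun P : {poly C} => P`_n.-1)).
rewrite coef_deriv coef0 prednK; last by lia.
have /eqP := monic_Q p; rewrite /lead_coef size_Q /= => -> /eqP.
by rewrite pnatr_eq0; lia.
Qed.

(* Since [Q n p = Q n 0 + c * p], a double root of [Q n p] is a critical point
   [x] of [Q n 0] and determines [p = - (Q n 0).[x] / c]. *)
Lemma critical_values :
  exists s : seq C, forall p, p \notin s -> separable_poly (Q n p).
Proof.
have [rs rsE] := @closed_field_poly_normal C (Q n 0)^`().
exists [seq - (Q n 0).[x] / c | x <- rs] => p ps.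
(* Over an algebraically closed field, coprimality with the derivative amounts to having no common
   root. *)
rewrite unlock; apply: Pdiv.ClosedField.root_coprimep => x.
have c0 : c != 0.
  by rewrite mulf_neq0 ?pnatr_eq0// invr_eq0 mulf_neq0 ?subn1_neq0 ?subn2_neq0.
rewrite {1}Q_shift rootE hornerD hornerC addrC addr_eq0 => /eqP px.
have -> : (Q n p)^`() = (Q n 0)^`() by rewrite Q_shift derivD derivC addr0.
apply: contra ps => /eqP dx; apply/mapP; exists x; last first.
  by rewrite -px mulrC mulKf.
rewrite -root_prod_XsubC.
have : root (Q n 0)^`() x by apply/eqP.
by rewrite rsE rootZ// lead_coef_eq0 deriv_Q_neq0.
Qed.

Lemma simple_roots (p : C) : separable_poly (Q n p) ->
  exists2 lam : 'I_n -> C, injective lam &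
    forall x, root (Q n p) x <-> exists k, x = lam k.
Proof.
have [rs] := @closed_field_poly_normal C (Q n p).
rewrite (monicP (monic_Q p)) scale1r => rsE.
have szrs : size rs = n.
  by apply: succn_inj; rewrite -(size_prod_XsubC rs id)/= -rsE size_Q.
rewrite rsE separable_prod_XsubC => urs; exists (fun k : 'I_n => rs`_k).
  move=> i j /eqP; rewrite nth_uniq ?szrs// => /eqP ij; exact: val_inj.
move=> x; rewrite root_prod_XsubC; split=> [xrs|[k ->]].
  have ix : (index x rs < n)%N by rewrite -szrs index_mem.
  by exists (Ordinal ix); rewrite /= nth_index.
by rewrite mem_nth// szrs.
Qed.

(** The Vandermonde determinant is the product of the differences of the [lam k], hence nonzero for
    injective [lam], and the solution is read off the inverse matrix. *)
Lemma amplitudes_unique_exists (lam : 'I_n -> C) (s : nat -> C) :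
  injective lam ->
  exists2 mu : 'I_n -> C, (forall m, (m < n)%N -> S_ lam mu m = s m) &
    forall nu : 'I_n -> C, (forall m, (m < n)%N -> S_ lam nu m = s m) ->
      nu = mu.
Proof.
move=> lam_inj; pose V := Vandermonde n (\row_j lam j).
have Vunit : V \in unitmx.
  rewrite unitmxE unitfE det_Vandermonde; apply/prodf_neq0 => i _.
  apply/prodf_neq0 => j ij; rewrite !mxE subr_eq0.
  by apply: contraTneq ij => /lam_inj ->; rewrite ltnn.
have systemE (mu : 'I_n -> C) : (forall m, (m < n)%N -> S_ lam mu m = s m) <->
    V *m (\col_j mu j) = \col_(i < n) s i.
  split=> [h|h m mn].
    apply/matrixP => i j; rewrite !mxE -(h i (ltn_ord i)).
    by apply: eq_bigr => k _; rewrite !mxE mulrC.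
  move: h => /matrixP/(_ (Ordinal mn) 0); rewrite !mxE /= => <-.
  by apply: eq_bigr => k _; rewrite !mxE mulrC.
exists (fun k => (invmx V *m \col_(i < n) s i) k 0).
  apply/systemE.
  rewrite (_ : \col__ _ = invmx V *m \col_(i < n) s i) ?mulKVmx//.
  by apply/matrixP => i j; rewrite mxE ord1.
move=> nu /systemE <-; rewrite mulKmx//.
by apply/funext => k; rewrite mxE.
Qed.

(** * Power sums up to index [2 * n] *)

Section Moments.
Variables (p : C) (lam mu : 'I_n -> C).
Hypothesis lam_root : forall k, root (Q n p) (lam k).
Hypothesis mu_system : amplitude_system p lam mu.

(** The relation [Q n p = 0] at [lam k], multiplied by [mu k * lam k ^+ m] and summed over [k]. *)
Lemma S_rec (m : nat) : S_ lam mu (m + n) =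
  c * (\sum_(1 <= j < n) (n%:R - j%:R - 1) * S_ lam mu (m + j))
  - (2 + c * p) * S_ lam mu m.
Proof.
have lamn k : lam k ^+ n =
    c * (\sum_(1 <= j < n) (n%:R - j%:R - 1) * lam k ^+ j) - (2 + c * p).
  have /eqP := lam_root k; rewrite horner_Q => /eqP.
  by rewrite addr_eq0 subr_eq => /eqP ->; rewrite addrC.
have -> : \sum_(1 <= j < n) (n%:R - j%:R - 1) * S_ lam mu (m + j) =
    \sum_(k < n) mu k * lam k ^+ m
      * \sum_(1 <= j < n) (n%:R - j%:R - 1) * lam k ^+ j.
  rewrite (eq_bigr (fun j => \sum_(k < n)
    mu k * lam k ^+ m * ((n%:R - j%:R - 1) * lam k ^+ j))); last first.
    move=> j _; rewrite mulr_sumr; apply: eq_bigr => k _.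
    by rewrite exprD; ring.
  by rewrite exchange_big/=; apply: eq_bigr => k _; rewrite mulr_sumr.
rewrite !mulr_sumr -sumrB; apply: eq_bigr => k _.
by rewrite exprD lamn; ring.
Qed.

Lemma S_low (m : nat) : (m < n.-1)%N -> S_ lam mu m = m%:R.
Proof.
by move=> mn; rewrite mu_system /s_ ?ifN//; lia.
Qed.

Lemma S_pred : S_ lam mu n.-1 = n%:R - 1 + p.
Proof. by rewrite mu_system ?/s_ ?eqxx//; lia. Qed.

(** Strong induction through the recurrence: each index [m + j] is below [n - 1], equals [n - 1], or
    is [m' + n] with [m' < m]. *)
Lemma S_mid (m : nat) : (m < n.-1)%N -> S_ lam mu (m + n) = (m + n)%:R.
Proof.
elim/ltn_ind: m => m IH mn.
rewrite S_rec (S_low mn).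
have -> : \sum_(1 <= j < n) (n%:R - j%:R - 1) * S_ lam mu (m + j) =
    \sum_(1 <= j < n) (n%:R - j%:R - 1) * (m + j)%:R + m%:R * p.
  (* Only [j = n - 1 - m] meets the defect [p], and its weight [n - j - 1] is [m]. The bound
     [m < n - 1] keeps this [j] at least 1, inside the range of summation. *)
  transitivity (\sum_(1 <= j < n) ((n%:R - j%:R - 1) * (m + j)%:R +
      (if j == (n.-1 - m)%N then m%:R * p else 0))).
    apply: eq_big_nat => j /andP[j1 jn].
    case: eqP => [->|jm].
      have -> : (m + (n.-1 - m) = n.-1)%N by lia.
      rewrite S_pred [(n.-1 - m)%:R]natrB; last by lia.
      by rewrite -subn1 natrB; [ring|lia].
    have [mjn|mjn] := ltnP (m + j) n.-1; first by rewrite S_low// addr0.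
    have -> : (m + j = (m + j - n) + n)%N by lia.
    by rewrite IH ?addr0//; lia.
  rewrite big_split/=; congr (_ + _).
  by rewrite -big_mkcond big_nat1_eq ifT//; lia.
by rewrite mulrDr weighted_sum_affine natrD; ring.
Qed.

(** [S_mid] supplies the values at [m + j] for [j < n - 1], and the term [j = n - 1] has weight
    zero. So at [m = n] the irregular value of [S_] at [2 * n - 1] does not enter. *)
Lemma S_high (m : nat) : (n.-1 <= m <= n)%N -> S_ lam mu (m + n) =
  3 * m%:R + n%:R - (2 + c * p) * S_ lam mu m.
Proof.
move=> mn; rewrite S_rec -weighted_sum_affine; congr (_ * _ - _).
apply: eq_big_nat => j /andP[j1 jn].
have [->|jE] := eqVneq j n.-1.
  by rewrite -subn1 natrB; [ring|lia].
have -> : (m + j = (m + j - n) + n)%N by lia.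
by rewrite S_mid//; lia.
Qed.

Lemma S_eq (m : nat) : (m < 2 * n)%N -> S_ lam mu m =
  m%:R + (if m == n.-1 then p else 0) + (if m == (2 * n).-1 then q0 n p else 0).
Proof.
move=> m2n; have [mn|mn] := ltnP m n.
  have mN : m != (2 * n).-1 by lia.
  rewrite mu_system// /s_ (negPf mN) addr0.
  case: eqP => [->|_]; last by rewrite addr0.
  by rewrite -subn1 natrB//; lia.
have mN : m != n.-1 by lia.
rewrite (negPf mN) addr0.
case: eqP => [->|mE]; last first.
  have mnE : (m = (m - n) + n)%N by lia.
  by rewrite mnE addr0; apply: S_mid; lia.
have -> : ((2 * n).-1 = n.-1 + n)%N by lia.
(* Inserting [n - 1 + p] for [S_] at [n - 1] gives a quadratic in [p], whose excess over [2 * n - 1]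
   is [q0 n p]. *)
rewrite S_high ?S_pred; last by lia.
rewrite natrD -subn1 natrB; last by lia.
by rewrite /q0; field; rewrite subn1_neq0 subn2_neq0.
Qed.

Lemma S_2n : (2 * n)%:R - S_ lam mu (2 * n) =
  6 * n%:R * p / ((n%:R - 1) * (n%:R - 2)).
Proof.
rewrite mul2n -addnn S_high ?leq_pred ?leqnn//.
have := @S_mid 0%N; rewrite add0n => ->; last by lia.
by rewrite natrD; field; rewrite subn1_neq0 subn2_neq0.
Qed.

End Moments.
End Algebra.

(** * Complex power series *)

Section GeometricBound.
Variable K : numFieldType.
Implicit Types (a b : nat -> K) (f : K -> K) (r M z w : K).

(** The order of [K] may be partial, so [B] must first be shown comparable with the norm of [l]: it
    is nonnegative, as it eventually bounds a norm. *)
Lemma cvg_norm_le (u : nat -> K) (l B : K) :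
  u @ \oo --> l -> (\forall N \near \oo, `|u N| <= B) -> `|l| <= B.
Proof.
move=> ul uB.
have B0 : 0 <= B by near \oo => N; rewrite (le_trans (normr_ge0 (u N)))//; near: N.
rewrite real_leNgt ?ger0_real//; apply/negP => Bl.
have /cvgrPdist_lt/(_ (`|l| - B)) := ul; rewrite subr_gt0 => /(_ Bl) lu.
near \oo => N; suff : `|l| < `|l| by rewrite ltxx.
rewrite -{1}(subrK (u N) l) (le_lt_trans (ler_normD _ _))//.
by rewrite -(subrK B `|l|) ltr_leD//; near: N.
Unshelve. all: by end_near. Qed.

Lemma geometric_sum_le (t : K) (k N : nat) : 0 <= t <= 2^-1 ->
  \sum_(k <= m < N) t ^+ m <= 2 * t ^+ k.
Proof.
move=> /andP[t0 t2]; have [Nk|/ltnW/subnKC <-] := leqP N k.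
  by rewrite big_geq// mulr_ge0// exprn_ge0.
have step j : t ^+ j + 2 * t ^+ j.+1 <= 2 * t ^+ j.
  rewrite exprS mulrA [leRHS]mulr_natl mulr2n lerD2l ler_piMl ?exprn_ge0//.
  by rewrite -ler_pdivlMl// mulr1.
(* Adding the bound [2 * t ^+ N] of the missing tail makes the claim inductive: by [step], the left
   side does not increase with the length. *)
suff : \sum_(k <= m < k + (N - k)) t ^+ m + 2 * t ^+ (k + (N - k)) <= 2 * t ^+ k.
  by apply: le_trans; rewrite lerDl mulr_ge0// exprn_ge0.
elim: (N - k)%N => [|d IH]; first by rewrite addn0 big_geq// add0r.
rewrite addnS big_nat_recr ?leq_addr//= -addrA (le_trans _ IH)//.
by rewrite lerD2l step.
Qed.

(** Comparison with a geometric series of ratio at most one half. The bound does not depend on [N],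
    so it passes to the limit. *)
Lemma tail_le a r M z (k N : nat) : 0 < r -> (forall m, `|a m| * r ^+ m <= M) ->
  `|z| <= r / 2 ->
  `|\sum_(k <= m < N) a m * z ^+ m| <= 2 * M * (`|z| / r) ^+ k.
Proof.
move=> r0 aM zr; rewrite (le_trans (ler_norm_sum _ _ _))//.
have M0 : 0 <= M by rewrite (le_trans _ (aM 0%N))// expr0 mulr1.
apply: (@le_trans _ _ (M * \sum_(k <= m < N) (`|z| / r) ^+ m)); last first.
  rewrite [2 * M]mulrC -mulrA ler_wpM2l// geometric_sum_le//.
  by rewrite divr_ge0 ?(ltW r0)//= ler_pdivrMr// mulrC.
rewrite mulr_sumr ler_sum// => m _; rewrite normrM normrX expr_div_n.
by rewrite mulrA mulrAC ler_wpM2r ?exprn_ge0// ler_pdivlMr ?exprn_gt0.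
Qed.

(** Half a radius of convergence is itself a point of convergence, so the terms there tend to 0 and
    are bounded. Later estimates use only this bound on the coefficients. *)
Lemma power_series_geometric_bound a (f : K -> K) :
  (\forall z \near 0, series (fun m => a m * z ^+ m) @ \oo --> f z) ->
  exists2 r, 0 < r &
    (forall z, `|z| <= r -> series (fun m => a m * z ^+ m) @ \oo --> f z) /\
    exists M, forall m, `|a m| * r ^+ m <= M.
Proof.
move=> /nbhs_ballP[e/= e0 ae]; have e20 : 0 < e / 2 by rewrite divr_gt0.
have af z : `|z| <= e / 2 -> series (fun m => a m * z ^+ m) @ \oo --> f z.
  move=> ze; apply: ae; rewrite -ball_normE/= sub0r normrN (le_lt_trans ze)//.
  by rewrite ltr_pdivrMr// ltr_pMr// ltr1n.
exists (e / 2) => //; split=> //.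
have norm_e2 : `|e / 2| = e / 2 by rewrite gtr0_norm.
have /cvg_series_cvg_0/cvgrPdist_lt/(_ _ ltr01)[N _ aN] :
    cvgn (series (fun m => a m * (e / 2) ^+ m)).
  by apply/cvg_ex; exists (f (e / 2)); apply: af; rewrite norm_e2.
(* From [N] on the terms are below 1; the finite sum bounds the earlier ones. *)
exists (1 + \sum_(0 <= m < N) `|a m| * (e / 2) ^+ m) => m.
have t0 j : 0 <= `|a j| * (e / 2) ^+ j by rewrite mulr_ge0// exprn_ge0// ltW.
have [mN|Nm] := ltnP m N.
  rewrite (bigD1_seq m) ?mem_index_iota ?iota_uniq//= addrCA lerDl.
  by rewrite addr_ge0// sumr_ge0.
rewrite (@le_trans _ _ 1)// ?lerDl ?sumr_ge0//.
by have := aN m Nm; rewrite sub0r normrN normrM normrX norm_e2 => /ltW.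
Qed.

(** Multipliers of growth [L ^+ m] only shrink the radius by [L]. This serves both the factor
    [m ^ 2] and the factor [m - S_m]. *)
Lemma geometric_bound_scale a b r M (B L : K) : 0 < L -> 0 <= B ->
  (forall m, `|b m| <= B * L ^+ m * `|a m|) ->
  (forall m, `|a m| * r ^+ m <= M) -> 0 < r ->
  forall m, `|b m| * (r / L) ^+ m <= B * M.
Proof.
move=> L0 B0 ba aM r0 m; rewrite expr_div_n mulrA ler_pdivrMr ?exprn_gt0//.
apply: (@le_trans _ _ (B * L ^+ m * `|a m| * r ^+ m)).
  by rewrite ler_wpM2r// exprn_ge0// ltW.
by rewrite -mulrA mulrAC ler_wpM2r ?exprn_ge0 ?(ltW L0)// ler_wpM2l.
Qed.

(** * Termwise differentiation *)

Lemma expr_sub_le (rho z w : K) m : `|z| <= rho -> `|w| <= rho ->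
  `|w ^+ m - z ^+ m| * rho <= m%:R * `|w - z| * rho ^+ m.
Proof.
move=> zr wr; have r0 : 0 <= rho by exact: le_trans zr.
elim: m => [|m IH]; first by rewrite !expr0 subrr normr0 !mul0r.
rewrite (_ : _ - _ = w * (w ^+ m - z ^+ m) + (w - z) * z ^+ m); last first.
  by rewrite !exprS; ring.
rewrite (le_trans (ler_wpM2r r0 (ler_normD _ _)))// !normrM mulrDl.
have -> : m.+1%:R * `|w - z| * rho ^+ m.+1 =
    rho * (m%:R * `|w - z| * rho ^+ m) + `|w - z| * rho ^+ m * rho.
  by rewrite -natr1 exprS; ring.
rewrite lerD// -?mulrA; first by rewrite ler_pM// ?mulr_ge0// mulrA.
by rewrite ler_wpM2l// ler_wpM2r// normrX lerXn2r// nnegrE.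
Qed.

(** The remainder for [m + 1] is [z] times the one for [m] plus [(w - z) * (w ^+ m - z ^+ m)], and
    [m ^ 2 + m] is at most [(m + 1) ^ 2]. The factor [rho ^+ 2] on the left replaces an exponent
    [m - 2]. *)
Lemma expr_taylor_le (rho z w : K) m : `|z| <= rho -> `|w| <= rho ->
  `|w ^+ m - z ^+ m - m%:R * z ^+ m.-1 * (w - z)| * rho ^+ 2
    <= m%:R ^+ 2 * `|w - z| ^+ 2 * rho ^+ m.
Proof.
move=> zr wr; have r0 : 0 <= rho by exact: le_trans zr.
elim: m => [|m IH].
  by rewrite !expr0 subrr !mul0r subr0 normr0 expr0n !mul0r.
rewrite (_ : _ - _ = z * (w ^+ m - z ^+ m - m%:R * z ^+ m.-1 * (w - z))
    + (w - z) * (w ^+ m - z ^+ m)); last first.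
  case: m {IH} => [|m]; first by rewrite !expr0; ring.
  by rewrite -[m.+2%:R]natr1 /= !exprS; ring.
rewrite (le_trans (ler_wpM2r _ (ler_normD _ _))) ?exprn_ge0// !normrM mulrDl.
apply: (@le_trans _ _ (rho * (m%:R ^+ 2 * `|w - z| ^+ 2 * rho ^+ m)
    + `|w - z| * (m%:R * `|w - z| * rho ^+ m) * rho)).
  rewrite lerD//; first by rewrite -mulrA ler_pM// mulr_ge0// exprn_ge0.
  rewrite -[leLHS]mulrA -[leRHS]mulrA ler_wpM2l// expr2 mulrA ler_wpM2r//.
  exact: expr_sub_le.
have -> : m.+1%:R ^+ 2 * `|w - z| ^+ 2 * rho ^+ m.+1 =
    rho * (m%:R ^+ 2 * `|w - z| ^+ 2 * rho ^+ m)
    + `|w - z| * (m%:R * `|w - z| * rho ^+ m) * rho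
    + m.+1%:R * `|w - z| ^+ 2 * rho ^+ m.+1.
  by rewrite -natr1 [rho ^+ m.+1]exprS; ring.
by rewrite lerDl !mulr_ge0// exprn_ge0.
Qed.

Lemma power_series_derivative_bound a r M : 0 < r ->
  (forall m, `|a m| * r ^+ m <= M) ->
  forall m, `|m%:R ^+ 2 * a m| * (r / 4) ^+ m <= M.
Proof.
move=> r0 aM; have /(_ _) := geometric_bound_scale (b := fun m => m%:R ^+ 2 * a m)
  (B := 1) (L := 4) (ltr0n _ 4) ler01 _ aM r0.
rewrite mul1r; apply=> m.
(* The scale 4 comes from [m ^ 2 <= 4 ^ m], the square of [m <= 2 ^ m]. *)
rewrite mul1r normrM ler_wpM2r// normrX normr_nat -!natrX ler_nat.
by rewrite -[4%N]/(2 ^ 2)%N expnAC leq_sqr ltnW// ltn_expl.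
Qed.

(** Since [r / 8] is half of [r / 4], the bound on [m ^ 2 * a m] yields the ratio one half. The
    division by [r / 8] accounts for the exponent [m.-1]. *)
Lemma derivative_term_le a r M z m : 0 < r ->
  (forall m, `|a m| * r ^+ m <= M) -> `|z| < r / 8 ->
  `|a m * (m%:R * z ^+ m.-1)| <= M / (r / 8) * 2^-1 ^+ m.
Proof.
move=> r0 aM; set rho := r / 8 => zr.
have rho0 : 0 < rho by rewrite divr_gt0.
have a2M := power_series_derivative_bound r0 aM.
rewrite mulrAC ler_pdivlMr//; case: m => [|m].
  by rewrite mul0r mulr0 normr0 mul0r mulr_ge0// (le_trans _ (aM 0%N))// expr0 mulr1.
apply: (@le_trans _ _ (`|m.+1%:R ^+ 2 * a m.+1| * rho ^+ m.+1)).
  rewrite [rho ^+ _]exprSr [leRHS]mulrA ler_wpM2r ?(ltW rho0)//.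
  rewrite !normrM !normrX !normr_nat.
  rewrite [`|a _| * _]mulrCA mulrA ler_pM ?mulr_ge0 ?exprn_ge0//.
    by rewrite ler_wpM2r// -natrM ler_nat leq_pmulr.
  by rewrite lerXn2r ?nnegrE ?(ltW rho0) ?(ltW zr).
rewrite (_ : rho = (r / 4) * 2^-1); last by rewrite /rho; field.
by rewrite exprMn mulrA ler_wpM2r ?exprn_ge0 ?invr_ge0.
Qed.

(** Summing [expr_taylor_le] bounds the error of the linear approximation by a multiple of the
    squared increment. Convergence of the derived series is assumed because [K] need not be
    complete. *)
Lemma is_derive_power_series a f (r M z : K) : 0 < r ->
  (forall m, `|a m| * r ^+ m <= M) ->
  (forall w, `|w| <= r / 8 -> series (fun m => a m * w ^+ m) @ \oo --> f w) ->
  `|z| < r / 8 -> cvgn (series (fun m => a m * (m%:R * z ^+ m.-1))) ->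
  exists2 g, is_derive z 1 f g &
    series (fun m => m%:R * a m * z ^+ m) @ \oo --> z * g.
Proof.
move=> r0 aM af zr /cvg_ex[g ug]; set rho := r / 8 in af zr.
have rho0 : 0 < rho by rewrite divr_gt0.
have a2M := power_series_derivative_bound r0 aM.
have taylor w : `|w| <= rho ->
    `|f w - f z - g * (w - z)| <= 2 * M / rho ^+ 2 * `|w - z| ^+ 2.
  move=> wr.
  have /cvg_norm_le : series (fun m =>
      a m * (w ^+ m - z ^+ m - m%:R * z ^+ m.-1 * (w - z))) @ \oo -->
      f w - f z - g * (w - z).
    rewrite (_ : series _ = (fun N => series (fun m => a m * w ^+ m) N
        - series (fun m => a m * z ^+ m) N
        - series (fun m => a m * (m%:R * z ^+ m.-1)) N * (w - z))).
      exact: (cvgB (cvgB (af w wr) (af z (ltW zr))) (cvgMr_tmp ug)).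
    apply/funext => N; rewrite /series/= mulr_suml -!sumrB.
    by apply: eq_bigr => m _; ring.
  apply; near=> N; rewrite mulrAC ler_pdivlMr ?exprn_gt0//.
  rewrite (le_trans (ler_wpM2r _ (ler_norm_sum _ _ _))) ?exprn_ge0 ?(ltW rho0)//.
  have a2M' m : `| `|m%:R ^+ 2 * a m| | * (r / 4) ^+ m <= M by rewrite normr_id.
  have rho_le : `|rho| <= r / 4 / 2.
    by rewrite gtr0_norm// (_ : r / 4 / 2 = rho)//; rewrite /rho; field.
  have r4_gt0 : 0 < r / 4 by rewrite divr_gt0.
  have := tail_le 0 N r4_gt0 a2M' rho_le.
  rewrite expr0 mulr1 ger0_norm; last first.
    by rewrite sumr_ge0// => m _; rewrite mulr_ge0// exprn_ge0// ltW.
  move=> sumM; rewrite [leRHS]mulrC.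
  apply: le_trans (ler_wpM2l (exprn_ge0 2 (normr_ge0 (w - z))) sumM).
  rewrite mulr_suml mulr_sumr ler_sum// => m _.
  rewrite normrM -mulrA.
  apply: le_trans (ler_wpM2l (normr_ge0 (a m)) (expr_taylor_le m (ltW zr) wr)) _.
  by rewrite normrM normrX normr_nat le_eqVlt; apply/orP; left; apply/eqP; ring.
have K0 : 0 <= 2 * M / rho ^+ 2.
  have M0 : 0 <= M by rewrite (le_trans _ (aM 0%N))// expr0 mulr1.
  by rewrite divr_ge0 ?exprn_ge0 ?(ltW rho0)// mulr_ge0.
have fg : h^-1 *: (f (h + z) - f z) @[h --> 0^'] --> g.
  apply/cvgrPdist_le => eps eps0; near=> h.
  have h0 : h != 0 by near: h; exact: nbhs_dnbhs_neq.
  have hz : `|h + z| <= rho.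
    have hlt : `|h| < rho - `|z|.
      by near: h; apply: dnbhs0_lt; rewrite subr_gt0.
    apply: le_trans (ler_normD _ _) _.
    by rewrite -lerBrDr; exact: ltW.
  have := taylor _ hz; rewrite addrK => tay.
  rewrite distrC (_ : h^-1 *: _ - g = (f (h + z) - f z - g * h) / h); last first.
    by rewrite /GRing.scale/=; field.
  rewrite normrM normfV ler_pdivrMr ?normr_gt0// (le_trans tay)//.
  rewrite [`|h| ^+ 2]expr2 mulrA ler_wpM2r//.
  (* Adding 1 makes the constant positive, so that [eps] can be divided by it even when [M = 0]. *)
  rewrite (@le_trans _ _ ((2 * M / rho ^+ 2 + 1) * `|h|))//.
    by rewrite ler_wpM2r// lerDl.
  have hK : `|h| < eps / (2 * M / rho ^+ 2 + 1).
    by near: h; apply: dnbhs0_lt; rewrite divr_gt0// ltr_wpDl.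
  rewrite -ler_pdivlMl ?ltr_wpDl// mulrC; exact: ltW.
exists g; last first.
  rewrite (_ : series _ = (fun N => z * series (fun m => a m * (m%:R * z ^+ m.-1)) N)).
    exact: (cvgMl_tmp ug).
  (* At index 0 the truncated exponent [m.-1] is harmless, both terms having the factor 0. *)
  apply/funext => N; rewrite /series/= mulr_sumr; apply: eq_bigr => -[|m] _.
    by rewrite !mul0r mulr0 mulr0.
  by rewrite exprS /=; ring.
split.
  apply/cvg_ex; exists g; move: fg; apply: cvg_trans.
  by apply: near_eq_cvg; near=> h; rewrite /= [h *: 1]mulr1.
rewrite -derive1E; exact: cvg_lim fg.
Unshelve. all: by end_near. Qed.

(** Once the coefficients below [k] vanish, the term of index [k] is the limit of minus the tails
    from [k + 1], hence of order [k + 1] in [z]. Dividing by [z ^+ k] and letting [z] tend to 0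
    gives [a k = 0]. *)
Lemma power_series_unique a :
  (\forall z \near 0, series (fun m => a m * z ^+ m) @ \oo --> 0) ->
  forall m, a m = 0.
Proof.
move=> a0; have [r r0 [_ [M aM]]] := power_series_geometric_bound a0.
have M0 : 0 <= M by rewrite (le_trans _ (aM 0%N))// expr0 mulr1.
elim/ltn_ind => k IH.
have coef_le : \forall z \near (0 : K)^', `|a k| <= 2 * M / r ^+ k.+1 * `|z|.
  near=> z.
  have z0 : z != 0 by near: z; exact: nbhs_dnbhs_neq.
  have zr : `|z| <= r / 2.
    by apply: ltW; near: z; apply: dnbhs0_lt; rewrite divr_gt0.
  have az : series (fun m => a m * z ^+ m) @ \oo --> 0.
    by near: z; apply: nbhs_dnbhs.
  have : `|a k * z ^+ k| <= 2 * M * (`|z| / r) ^+ k.+1.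
    apply: (cvg_norm_le (u := fun N => a k * z ^+ k
        - series (fun m => a m * z ^+ m) N)).
      by rewrite -[X in _ --> X]subr0; exact: cvgB (cvg_cst _) az.
    near=> N; have kN : (k < N)%N by near: N; exists k.+1.
    rewrite /series/= (@big_cat_nat _ _ _ k)//=; last exact: ltnW.
    rewrite big_nat big1 ?add0r => [|m /andP[_ mk]]; last by rewrite IH ?mul0r.
    rewrite big_ltn// opprD addNKr normrN.
    exact: tail_le.
  rewrite normrM normrX expr_div_n exprS => akz.
  rewrite -(ler_pM2r (_ : 0 < `|z| ^+ k)) ?exprn_gt0 ?normr_gt0//.
  by rewrite (le_trans akz)// le_eqVlt; apply/orP; left; apply/eqP; ring.
apply/eqP; apply/negPn/negP; rewrite -normr_gt0 => ak0.
have K0 : 0 <= 2 * M / r ^+ k.+1.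
  by rewrite divr_ge0 ?exprn_ge0 ?(ltW r0)// mulr_ge0.
near (0 : K)^' => z; suff : `|a k| < `|a k| by rewrite ltxx.
have ak_le : `|a k| <= 2 * M / r ^+ k.+1 * `|z| by near: z.
rewrite (le_lt_trans ak_le)//.
rewrite (@le_lt_trans _ _ ((2 * M / r ^+ k.+1 + 1) * `|z|))//.
  by rewrite ler_wpM2r// lerDl.
rewrite -ltr_pdivlMl ?ltr_wpDl// mulrC; near: z; apply: dnbhs0_lt.
by rewrite divr_gt0// ltr_wpDl.
Unshelve. all: by end_near. Qed.

End GeometricBound.

(** * Dominated series of complex numbers *)

Section ComplexSeries.
Variable R : realType.
Local Notation C := (Cplx R).
Implicit Types (a : nat -> C) (f : C -> C).

Lemma cvg_realC (v : nat -> R) (l : R) :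
  v @ \oo --> l -> (fun N => realC (v N)) @ \oo --> realC l.
Proof.
move=> vl; apply/cvgrPdist_lt => eps eps0.
(* A positive element of [Cplx R] is real, so [eps] comes from [R]. *)
have epsE : eps = realC (complex.Re eps).
  by rewrite /realC RRe_real// ger0_real// ltW.
move: eps0; rewrite epsE => eps0.
have {}eps0 : 0 < complex.Re eps by rewrite -ltcR.
move/cvgrPdist_lt: vl => /(_ _ eps0); apply: filterS => N.
by rewrite /realC -rmorphB/= normc_def/= expr0n addr0 sqrtr_sqr ltcR.
Qed.

Lemma cvg_series_Re_dominated (u : nat -> C) (M : R) :
  (forall m, `|u m| <= realC (M * 2^-1 ^+ m)) ->
  cvgn (series (fun m => complex.Re (u m))).
Proof.
move=> uM; apply: normed_cvg.
apply: (@series_le_cvg _ _ (fun m => M * 2^-1 ^+ m)) => [m|m|m|].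
- exact: normr_ge0.
- by have := le_trans (normr_ge0 _) (uM m); rewrite (lecR 0).
- by have := le_trans (normc_ge_Re _) (uM m); rewrite lecR.
- by apply: is_cvg_geometric_series; rewrite ger0_norm ?invr_ge0// invf_lt1 ?ltr1n.
Qed.

(** Reduction to real series: the imaginary part is minus the real part of [u m * 'i], so
    [cvg_series_Re_dominated] handles both parts. *)
Lemma cvg_series_dominated (u : nat -> C) (M : C) :
  (forall m, `|u m| <= M * 2^-1 ^+ m) -> cvgn (series u).
Proof.
move=> uM; have M0 : 0 <= M.
  by have := le_trans (normr_ge0 _) (uM 0%N); rewrite expr0 mulr1.
have {}uM m : `|u m| <= realC (complex.Re M * 2^-1 ^+ m).
  rewrite (le_trans (uM m))// /realC rmorphM/= RRe_real ?ger0_real//.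
  by rewrite rmorphXn/= fmorphV/= rmorph_nat.
have /cvg_ex[x ux] := cvg_series_Re_dominated uM.
have /cvg_ex[y uy] : cvgn (series (fun m => complex.Re (u m * 'i%C))).
  apply: cvg_series_Re_dominated => m.
  apply: le_trans (uM m); rewrite normrM.
  by rewrite [`|'i%C|]normc_def/= expr0n expr1n add0r sqrtr1 mulr1.
pose i : C := 'i%C; apply/cvg_ex; exists (realC x - i * realC y).
have -> : series u = (fun N => realC (series (fun m => complex.Re (u m)) N)
    - i * realC (series (fun m => complex.Re (u m * 'i%C)) N)).
  apply/funext => N; rewrite /series/= /realC !rmorph_sum mulr_sumr -sumrB.
  apply: eq_bigr => m _.
  by rewrite /= ReiNIm rmorphN mulrN opprK -complexE.
exact: (cvgB (cvg_realC ux) (cvgMl_tmp (cvg_realC uy))).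
Qed.

Lemma cvg_derivative_power_series a (r M z : C) : 0 < r ->
  (forall m, `|a m| * r ^+ m <= M) -> `|z| < r / 8 ->
  cvgn (series (fun m => a m * (m%:R * z ^+ m.-1))).
Proof.
move=> r0 aM zr.
apply: (cvg_series_dominated (M := M / (r / 8))) => m.
exact: derivative_term_le r0 aM zr.
Qed.

End ComplexSeries.

(** * The differentiation formula *)

Section Remainder.
Variable K : numFieldType.
Variables (n : nat) (lam mu : 'I_n -> K).
Local Notation S m := (\sum_(k < n) mu k * lam k ^+ m).

Lemma moment_growth : exists L, [/\ 1 <= L, forall k, `|lam k| <= L &
  exists2 B, 0 <= B & forall m, `|m%:R - S m| <= B * L ^+ m].
Proof.
(* The sum dominates every [lam k]; the 2 gives [m <= 2 ^ m <= L ^+ m]. *)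
pose L := 2 + \sum_(k < n) `|lam k|.
have sum_ge0 (g : 'I_n -> K) : 0 <= \sum_(k < n) `|g k| by rewrite sumr_ge0.
have L2 : 2 <= L by rewrite lerDl.
have L0 : 0 <= L by rewrite (le_trans _ L2).
have lamL k : `|lam k| <= L.
  by rewrite /L (bigD1 k)//= addrCA lerDl addr_ge0// sumr_ge0.
exists L; split=> //; first by rewrite (le_trans _ L2)// ler1n.
exists (1 + \sum_(k < n) `|mu k|); first by rewrite addr_ge0.
move=> m; rewrite (le_trans (ler_normB _ _))// mulrDl mul1r lerD//.
  rewrite normr_nat (@le_trans _ _ (2 ^+ m))//.
    by rewrite -natrX ler_nat ltnW// ltn_expl.
  by rewrite lerXn2r// nnegrE.
rewrite (le_trans (ler_norm_sum _ _ _))// mulr_suml ler_sum// => k _.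
by rewrite normrM normrX ler_wpM2l// lerXn2r// nnegrE.
Qed.

(** Presents a single monomial as a series, so that the correction terms take part in identities
    between partial sums. *)
Lemma series_delta (j : nat) (x : K) :
  series (fun m => if m == j then x else 0) @ \oo --> x.
Proof.
apply: cvg_near_cst; near=> N.
rewrite /series/= -big_mkcond big_nat1_eq ifT//=.
by near: N; exists j.+1.
Unshelve. all: by end_near. Qed.

End Remainder.

(** Pigeonhole: among [size s + 1] distinct points [p0 + eps / (j + 1)], one lies outside [s]. *)
Lemma exists_near_notin (R : realType) (p0 : Cplx R) (eps : R)
    (s : seq (Cplx R)) : 0 < eps ->
  exists2 p, `|p - p0| <= realC eps & p \notin s.
Proof.
move=> eps0; pose g j : Cplx R := p0 + realC (eps / j.+1%:R).
have g_inj : injective g.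
  move=> i j /addrI/complexI/(mulfI (lt0r_neq0 eps0))/invr_inj/eqP.
  by rewrite eqr_nat eqSS => /eqP.
have [/allP gs|/allPn[_ /mapP[j _ ->] gj]] :=
    boolP (all (mem s) [seq g j | j <- iota 0 (size s).+1]).
  have := uniq_leq_size _ gs; rewrite map_inj_uniq// iota_uniq size_map size_iota.
  by rewrite ltnn => /(_ isT).
exists (g j) => //; rewrite /g addrC addKr.
have e0 : 0 <= eps / j.+1%:R by rewrite divr_ge0// ltW.
rewrite /realC ger0_norm ?(lecR 0)// lecR ler_pdivrMr//.
by rewrite ler_pMr// ler1n.
Qed.

(** * The formula and its remainder for a fixed [f] *)

Section Differentiation.
Variables (R : realType) (n : nat).
Hypothesis n_ge3 : (3 <= n)%N.
Local Notation C := (Cplx R).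
Variables (p : C) (lam mu : 'I_n -> C).
Hypothesis lam_root : forall k, root (Q n p) (lam k).
Hypothesis mu_system : amplitude_system p lam mu.
Variables (fc : nat -> C) (f : C -> C).
Hypothesis fE : power_series_at0 fc f.

(** An exact identity at every [N]: by [S_eq] the terms with [m < 2 * n] cancel against the two
    corrections. *)
Lemma rem_partialE (z : C) : rem_partial lam mu fc z = (fun N =>
  series (fun m => m%:R * fc m * z ^+ m) N
  - \sum_(k < n) mu k * series (fun m => fc m * (lam k * z) ^+ m) N
  + series (fun m => if m == n.-1 then p * fc n.-1 * z ^+ n.-1 else 0) N
  + series (fun m => if m == (2 * n).-1
      then q0 n p * fc (2 * n).-1 * z ^+ (2 * n).-1 else 0) N).
Proof.
apply/funext => N; rewrite /rem_partial /series/=.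
rewrite (big_nat_widenl _ 0)//= big_mkcond/=.
have -> : \sum_(k < n) mu k * \sum_(0 <= m < N) fc m * (lam k * z) ^+ m =
    \sum_(0 <= m < N) S_ lam mu m * (fc m * z ^+ m).
  under eq_bigr do rewrite mulr_sumr.
  rewrite exchange_big/=; apply: eq_bigr => m _.
  by rewrite mulr_suml; apply: eq_bigr => k _; rewrite exprMn; ring.
rewrite -sumrB -!big_split/=; apply: eq_bigr => m _.
have [m2n|m2n] := leqP (2 * n) m.
  rewrite ifN; last by lia.
  by rewrite ifN; [ring|lia].
rewrite (S_eq n_ge3 lam_root mu_system m2n).
case: eqP => [->|_]; case: eqP => [->|_]; try lia; ring.
Qed.

Lemma cvg_rem_partial : \forall z \near (0 : C),
  exists2 g : C, is_derive (z : C) (1 : C) f g &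
  rem_partial lam mu fc z @ \oo --> z * g - \sum_(k < n) mu k * f (lam k * z)
    + p * fc n.-1 * z ^+ n.-1
    + q0 n p * fc (2 * n).-1 * z ^+ (2 * n).-1.
Proof.
have [r r0 [af [M aM]]] := power_series_geometric_bound fE.
have [L [L1 lamL _]] := moment_growth lam mu.
have L0 : 0 < L by exact: lt_le_trans L1.
(* Dividing by [L] keeps every [lam k * z] in the disc of convergence, and [L >= 1] keeps [z] within
   [r / 8], where [f] is differentiated termwise. *)
have : \forall z \near (0 : C), `|z| < r / 8 / L.
  by apply: nbhs0_lt; rewrite !divr_gt0.
apply: filterS => z; rewrite ltr_pdivlMr// => zL.
have r8 : r / 8 <= r by rewrite ler_piMr ?(ltW r0)// invf_le1// ler1n.
have z8 : `|z| < r / 8 by rewrite (le_lt_trans _ zL)// ler_peMr.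
have af8 w : `|w| <= r / 8 -> series (fun m => fc m * w ^+ m) @ \oo --> f w.
  by move=> wr; apply: af; exact: le_trans wr r8.
have [g fg zg] := is_derive_power_series r0 aM af8 z8
  (cvg_derivative_power_series r0 aM z8).
exists g; first exact: fg.
rewrite rem_partialE.
have sum_cvg : \sum_(k < n) mu k * series (fun m => fc m * (lam k * z) ^+ m) N
    @[N --> \oo] --> \sum_(k < n) mu k * f (lam k * z).
  apply: cvg_big => [|k _]; first exact: add_continuous.
  apply: cvgMl_tmp; apply: af; rewrite normrM mulrC.
  by rewrite (le_trans _ (le_trans (ltW zL) r8))// ler_wpM2l.
apply: cvgD; last exact: series_delta.
apply: cvgD; last exact: series_delta.
exact: cvgB zg sum_cvg.
Qed.

Lemma rem_formula : \forall z \near (0 : C),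
  derivable f z 1 /\ cvgn (rem_partial lam mu fc z) /\
  z * f^`()%classic z = \sum_(k < n) mu k * f (lam k * z)
    - p * fc n.-1 * z ^+ n.-1 - q0 n p * fc (2 * n).-1 * z ^+ (2 * n).-1
    + rem_ lam mu fc z.
Proof.
apply: filterS cvg_rem_partial => z [g fg remg].
have remE : rem_ lam mu fc z = _ := cvg_lim (@norm_hausdorff _ _) remg.
split; first by case: fg.
split; first by apply/cvg_ex; eexists; exact: remg.
by rewrite derive1E (@derive_val _ _ _ _ _ _ _ fg) remE; ring.
Qed.

(** The coefficients [(m - S_m) * fc m] inherit a geometric bound at radius [r / L]; halving it
    meets the requirement of [tail_le]. The cases [k = 2 * n] and [k = 2 * n + 1] give the two
    orders of the remainder. *)
Lemma rem_tail_le : exists c d : C, [/\ 0 < d, 0 <= c &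
  forall z k N, `|z| < d ->
  `|\sum_(k <= m < N) (m%:R - S_ lam mu m) * fc m * z ^+ m|
    <= c * (`|z| / d) ^+ k].
Proof.
have [r r0 [af [M aM]]] := power_series_geometric_bound fE.
have [L [L1 _ [B B0 SB]]] := moment_growth lam mu.
have L0 : 0 < L by exact: lt_le_trans L1.
have rL0 : 0 < r / L by rewrite divr_gt0.
have bM : forall m, `|(m%:R - S_ lam mu m) * fc m| * (r / L) ^+ m <= B * M.
  apply: geometric_bound_scale aM r0 => // m.
  by rewrite normrM ler_wpM2r.
have M0 : 0 <= M by rewrite (le_trans _ (aM 0%N))// expr0 mulr1.
have d0 : 0 < r / L / 2 by rewrite divr_gt0.
exists (2 * (B * M)), (r / L / 2); split=> //; first by rewrite !mulr_ge0.
move=> z k N zd; apply: le_trans (tail_le k N rL0 bM (ltW zd)) _.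
have q_le : `|z| / (r / L) <= `|z| / (r / L / 2).
  rewrite ler_wpM2l// lef_pV2 ?posrE// ler_piMr ?(ltW rL0)//.
  by rewrite invf_le1// ler1n.
by rewrite ler_wpM2l ?mulr_ge0// lerXn2r// nnegrE mulr_ge0// invr_ge0 ltW.
Qed.

Lemma eqO_expr (h : C -> C) (c d : C) (j : nat) : 0 < d -> 0 <= c ->
  (\forall z \near (0 : C), `|h z| <= c * (`|z| / d) ^+ j) ->
  h =O_ (nbhs (0 : C)) (fun z => z ^+ j).
Proof.
move=> d0 c0 hc; apply/eqO_exP; exists (c / d ^+ j + 1).
  by rewrite ltr_wpDl// divr_ge0// exprn_ge0// ltW.
apply: filterS hc => z hz; rewrite (le_trans hz)// mulrDl mul1r expr_div_n.
by rewrite normrX mulrCA mulrC lerDl exprn_ge0.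
Qed.

Lemma cvg_rem : \forall z \near (0 : C),
  rem_partial lam mu fc z @ \oo --> rem_ lam mu fc z.
Proof. by apply: filterS rem_formula => z [_ []]. Qed.

Lemma rem_eqO : rem_ lam mu fc =O_ (nbhs (0 : C)) (fun z => z ^+ (2 * n)).
Proof.
have [c [d [d0 c0 tail]]] := rem_tail_le.
have d_near : \forall z \near (0 : C), `|z| < d by apply: nbhs0_lt.
apply: (eqO_expr d0 c0); apply: filterS2 cvg_rem d_near => z remz zd.
by apply: (cvg_norm_le remz); apply: nearW => N; exact: tail.
Qed.

Lemma rem_lead_eqO :
  (fun z => rem_ lam mu fc z - 6 * n%:R * p / ((n%:R - 1) * (n%:R - 2))
     * fc (2 * n)%N * z ^+ (2 * n))
  =O_ (nbhs (0 : C)) (fun z => z ^+ (2 * n).+1).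
Proof.
have [c [d [d0 c0 tail]]] := rem_tail_le.
have d_near : \forall z \near (0 : C), `|z| < d by apply: nbhs0_lt.
apply: (eqO_expr d0 c0); apply: filterS2 cvg_rem d_near => z remz zd.
set lead := _ * z ^+ (2 * n).
apply: (cvg_norm_le (u := fun N => rem_partial lam mu fc z N - lead)).
  exact: cvgB remz (cvg_cst _).
near=> N.
have nN : (2 * n < N)%N by near: N; exists (2 * n).+1.
(* The term [m = 2 * n] is exactly [lead], which leaves the tail from [2 * n + 1]. *)
rewrite /rem_partial big_ltn// (S_2n n_ge3 lam_root mu_system) addrC addKr.
exact: tail.
Unshelve. all: by end_near. Qed.

(** Uniqueness of coefficients gives [fc m = 0] for [m >= 2 * n]. All partial sums of the remainder
    then vanish identically, hence at every [z] and not only near 0. *)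
Lemma rem_polynomial (P : {poly C}) : (size P <= 2 * n)%N ->
  (\forall z \near (0 : C), f z = P.[z]) -> forall z, rem_ lam mu fc z = 0.
Proof.
move=> szP fP z.
have fcP : forall m, fc m - P`_m = 0.
  apply: power_series_unique; move: fE fP; apply: filterS2 => w fw fPw.
  rewrite -[X in _ --> X](subrr (f w)) {2}fPw.
  rewrite (_ : series _ = (fun N => series (fun m => fc m * w ^+ m) N
      - series (fun m => P`_m * w ^+ m) N)); last first.
    apply/funext => N; rewrite /series/= -sumrB.
    by apply: eq_bigr => m _; rewrite mulrBl.
  apply: cvgB fw _; apply: cvg_near_cst; near=> N.
  rewrite (@horner_coef_wide _ N) ?/series/= ?big_mkord//.
  by near: N; exists (size P).
rewrite /rem_ (_ : rem_partial _ _ _ _ = fun=> 0) ?lim_cst//.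
apply/funext => N; rewrite /rem_partial big_nat big1// => m /andP[nm _].
have /eqP := fcP m; rewrite (nth_default _ (leq_trans szP nm)) subr0 => /eqP ->.
by rewrite mulr0 mul0r.
Unshelve. all: by end_near. Qed.

End Differentiation.

Theorem theorem4 (R : realType) (n : nat) (hn : (3 <= n)%N)
    (p0 : Cplx R) (eps : R) (heps : 0 < eps) :
  exists p : Cplx R,
    `|p - p0| <= realC eps /\ ~ PiHat n p /\
    exists lam : 'I_n -> Cplx R,
      injective lam /\
      (forall x : Cplx R, root (Q n p) x <-> exists k : 'I_n, x = lam k) /\
      exists mu : 'I_n -> Cplx R,
        amplitude_system p lam mu /\
        (forall nu : 'I_n -> Cplx R, amplitude_system p lam nu -> nu = mu) /\
        forall (fc : nat -> Cplx R) (f : Cplx R -> Cplx R),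
          power_series_at0 fc f ->
          (\forall z \near (0 : Cplx R),
             derivable f z 1 /\
             cvgn (rem_partial lam mu fc z) /\
             z * f^`()%classic z =
               \sum_(k < n) mu k * f (lam k * z)
               - p * fc n.-1 * z ^+ n.-1
               - q0 n p * fc (2 * n).-1 * z ^+ (2 * n).-1
               + rem_ lam mu fc z) /\
          ((fun z : Cplx R =>
              rem_ lam mu fc z
              - 6 * n%:R * p / ((n%:R - 1) * (n%:R - 2))
                * fc (2 * n)%N * z ^+ (2 * n))
             =O_ (nbhs (0 : Cplx R)) (fun z : Cplx R => z ^+ (2 * n).+1)) /\
          (rem_ lam mu fc
             =O_ (nbhs (0 : Cplx R)) (fun z : Cplx R => z ^+ (2 * n))) /\
          (forall P : {poly Cplx R}, (size P <= 2 * n)%N ->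
             (\forall z \near (0 : Cplx R), f z = P.[z]) ->
             forall z : Cplx R, rem_ lam mu fc z = 0).
Proof.
have [crit sep] := critical_values R hn.
(* The points of [PiHat] and the critical values form one finite list to be avoided. *)
pose exc : seq (Cplx R) := [:: 0; n%:R / 2 * (1 - n%:R + d_ R n);
  n%:R / 2 * (1 - n%:R - d_ R n)].
have [p pp0] := exists_near_notin p0 (exc ++ crit) heps.
rewrite mem_cat negb_or => /andP[pexc /sep sepQ].
exists p; split=> //; split.
  by move=> [[]|] pE; move: pexc; rewrite pE !inE eqxx ?orbT.
have [lam lam_inj lam_roots] := simple_roots hn sepQ.
have lam_root k : root (Q n p) (lam k) by apply/lam_roots; exists k.
have [mu mu_sys mu_uniq] := amplitudes_unique_exists (s_ n p) lam_inj.
exists lam; split=> //; split=> //; exists mu; split=> //; split=> //.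
move=> fc f fE; split; first exact: (rem_formula hn lam_root mu_sys fE).
split; first exact: (rem_lead_eqO hn lam_root mu_sys fE).
split; first exact: (rem_eqO hn lam_root mu_sys fE).
exact: (rem_polynomial _ _ fE).
Qed.
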